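(* For every interval graph $G$ with $n\ge1$ vertices, $\Gamma_{\mathrm{CZ}}(|G\rangle)\le 2n-2$. For every circle graph $G$ with $n\ge1$ vertices, $\Gamma_{\mathrm{CZ}}(|G\rangle)\le 1.262\cdot(n-1)\log_2(n+1)$.
   Context: Graphs are finite, simple and undirected. The Pauli group $\mathcal{G}_n$ consists of all $\alpha h_1\otimes\dots\otimes h_n$ with $\alpha\in\{\pm1,\pm i\}$, $h_j\in\{I_2,X,Y,Z\}$. The $n$-qubit Clifford group is $\mathcal{C}_n=\{U\in U(2^n): U\mathcal{G}_nU^\dagger=\mathcal{G}_n\}$. For a graph $G=(V,E)$ with $V=\{1,\dots,n\}$, the graph state $|G\rangle$ is the $n$-qubit state (unique up to global phase) that is fixed by $X_v\otimes\bigotimes_{w\in N_G(v)}Z_w$ for all $v\in V$. States are considered up to global phase. CZ-complexity: a quantum algorithm consists of (1) measurements of qubits in the computational basis (measured qubits are discarded); (2) single-qubit Clifford operations; (3) two-qubit Clifford operations (elements of $\mathcal{C}_2$ applied to any pair of qubits); later operations may depend on earlier measurement outcomes. Its CZ-complexity is the maximum, over measurement outcomes, of the number of two-qubit Clifford operations. $\Gamma_{\mathrm{CZ}}(|G\rangle)$ is the minimum CZ-complexity of an algorithm that generates $|G\rangle$ from $|0\rangle^{\otimes(n+s)}$ with probability $1$ for some $s\ge0$. A double occurrence word over a finite set $V$ is a word in which every letter of $V$ appears exactly twice. The interval graph of a double occurrence word $m$ over $V$ has vertex set $V$ and an edge between distinct $a,b$ iff (for one of the two ways of naming the pair) the occurrences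 of $a$ and $b$ in $m$ appear in the order $abba$ or $abab$. The circle graph of $m$ has vertex set $V$ and an edge between distinct $a,b$ iff (for one of the two ways of naming the pair) they appear in the order $abab$. A graph is an interval graph (circle graph) if it is the interval graph (circle graph) of some double occurrence word. *)

(* Defs.v *)
From HB Require Import structures.
From mathcomp Require Import all_boot all_order all_algebra.
From mathcomp Require Import spectral complex.
From mathcomp Require Import boolp classical_sets reals ereal exp.

Set Implicit Arguments.
Unset Strict Implicit.
Unset Printing Implicit Defensive.

Import Order.TTheory GRing.Theory Num.Theory.

Local Open Scope ring_scope.
Local Open Scope sesquilinear_scope.
Local Open Scope classical_set_scope.

Record sgraph (n : nat) := SGraph {
  edge :> rel 'I_n;
  edge_sym : symmetric edge;
  edge_irr : irreflexive edge
}.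

Definition double_occurrence_word n (m : seq 'I_n) : Prop :=
  forall v, count_mem v m = 2%N.

Definition subword n (m : seq 'I_n) (a b : 'I_n) : seq 'I_n :=
  [seq x <- m | (x == a) || (x == b)].

Definition interlaced n (m : seq 'I_n) (a b : 'I_n) : bool :=
  subword m a b \in [:: [:: a; b; a; b]; [:: b; a; b; a]].

Definition nested n (m : seq 'I_n) (a b : 'I_n) : bool :=
  subword m a b \in [:: [:: a; b; b; a]; [:: b; a; a; b]].

Definition interval_graph n (G : sgraph n) : Prop :=
  exists2 m, double_occurrence_word m &
    forall a b, G a b = (a != b) && (nested m a b || interlaced m a b).

Definition circle_graph n (G : sgraph n) : Prop :=
  exists2 m, double_occurrence_word m &
    forall a b, G a b = (a != b) && interlaced m a b.

(* The computational basis of n qubits is indexed by the bit strings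
   ['I_n -> 'I_2], so that the dimension 2^n appears as the cardinality of the
   set of these strings; [amp] and [mx_of] translate between bit strings and
   matrix indices. *)
Definition bits (n : nat) : finType := {ffun 'I_n -> 'I_2}.
Definition dim (n : nat) : nat := #|bits n|.

(* The complex numbers are [R[i]] over an arbitrary [R : realType]. *)
Section Qubits.
Variable R : realType.
Local Notation C := R[i].

Definition operator (n : nat) := 'M[C]_(dim n).
Definition state (n : nat) := 'cV[C]_(dim n).

Definition mx_of n (F : bits n -> bits n -> C) : operator n :=
  \matrix_(i, j) F (enum_val i) (enum_val j).
Definition state_of n (f : bits n -> C) : state n :=
  \col_i f (enum_val i).
Definition entry n (U : operator n) (x y : bits n) : C :=
  U (enum_rank x) (enum_rank y).
Definition amp n (psi : state n) (x : bits n) : C := psi (enum_rank x) 0.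

Definition sqnorm n (psi : state n) : C := \sum_(x : bits n) `|amp psi x| ^+ 2.

Definition tensor n (h : 'I_n -> 'M[C]_2) : operator n :=
  mx_of (fun x y => \prod_(j < n) h j (x j) (y j)).

Definition pauliX : 'M[C]_2 := \matrix_(i, j) (i != j)%:R.
Definition pauliZ : 'M[C]_2 := \matrix_(i, j) ((-1) ^+ i * (i == j)%:R).
Definition pauliY : 'M[C]_2 := 'i%C *: (pauliX *m pauliZ).

Definition pauli_group n : set (operator n) :=
  [set P | exists alpha h,
    [/\ alpha \in [:: 1; -1; 'i%C; - 'i%C],
        forall j, h j \in [:: 1%:M; pauliX; pauliY; pauliZ]
      & P = alpha *: tensor h]].

Definition clifford n (U : operator n) : Prop :=
  U \is unitarymx /\
  [set U *m P *m U^t* | P in @pauli_group n] = @pauli_group n.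

Definition graph_stabilizer n (G : sgraph n) (v : 'I_n) : operator n :=
  tensor (fun w => if w == v then pauliX else if G v w then pauliZ else 1%:M).

(* [psi] is a (possibly unnormalized) representative of the graph state |G>. *)
Definition is_graph_state n (G : sgraph n) (psi : state n) : Prop :=
  psi != 0 /\ forall v, graph_stabilizer G v *m psi = psi.

(* [U] acting on the qubits [q 0, ..., q (k-1)], tensored with the identity on
   the other qubits. *)
Definition act_on n k (q : 'I_k -> 'I_n) (U : operator k) : operator n :=
  mx_of (fun x y =>
    entry U [ffun l => x (q l)] [ffun l => y (q l)] *
    [forall j, (j \in codom q) || (x j == y j)]%:R).

Definition insert_bit n (v : 'I_n.+1) (b : 'I_2) (x : bits n) : bits n.+1 :=
  [ffun j => if unlift v j is Some l then x l else b].

(* The unnormalized state after measuring qubit [v] with outcome [b] and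
   discarding it; the other qubits keep their relative order. *)
Definition measured n (v : 'I_n.+1) (b : 'I_2) (psi : state n.+1) : state n :=
  state_of (fun x => amp psi (insert_bit v b x)).

Definition zero_state n : state n :=
  state_of (fun x => [forall j, x j == 0]%:R).

(* [algorithm n m]: adaptive algorithms that act on m qubits and end with n
   qubits; the continuation of a measurement may depend on its outcome. *)
Inductive algorithm (n : nat) : nat -> Type :=
| Stop : algorithm n n
| Measure m (v : 'I_m.+1) (next : 'I_2 -> algorithm n m) : algorithm n m.+1
| Gate1 m (v : 'I_m) (U : operator 1) (_ : clifford U)
    (next : algorithm n m) : algorithm n m
| Gate2 m (q : 'I_2 -> 'I_m) (_ : injective q) (U : operator 2)
    (_ : clifford U) (next : algorithm n m) : algorithm n m.

Fixpoint cz_complexity n m (A : algorithm n m) : nat :=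
  match A with
  | Stop => 0%N
  | Measure _ _ next => \max_(b < 2) cz_complexity (next b)
  | Gate1 _ _ _ _ next => cz_complexity next
  | Gate2 _ _ _ _ _ next => (cz_complexity next).+1
  end.

(* The probability that [A], run on [psi], ends in a state with property [S].
   States are not renormalized after a measurement, so the squared norm of the
   state at a leaf is the joint probability of the outcomes leading to it. *)
Fixpoint final_prob n (S : state n -> Prop) m (A : algorithm n m) :
    state m -> C :=
  match A in algorithm _ m return state m -> C with
  | Stop => fun psi => if `[< S psi >] then sqnorm psi else 0
  | Measure _ v next => fun psi =>
      \sum_(b < 2) final_prob S (next b) (measured v b psi)
  | Gate1 _ v U _ next => fun psi =>
      final_prob S next (act_on (fun _ : 'I_1 => v) U *m psi)
  | Gate2 _ q _ U _ next => fun psi =>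
      final_prob S next (act_on q U *m psi)
  end.

Definition generates n (G : sgraph n) s (A : algorithm n (n + s)) : Prop :=
  final_prob (is_graph_state G) A (zero_state (n + s)) = 1.

(* The infimum of a nonempty set of natural numbers is its minimum; the
   infimum of the empty set is +oo. *)
Definition Gamma_CZ n (G : sgraph n) : \bar R :=
  ereal_inf [set (k%:R)%:E | k in
    [set k : nat | exists s (A : algorithm n (n + s)),
       generates G A /\ cz_complexity A = k]].

End Qubits.

Definition log2 (R : realType) (x : R) : R := ln x / ln 2.

(* Main.v *)
Require Import Defs.
From HB Require Import structures.
From mathcomp Require Import all_boot all_order all_algebra.
From mathcomp Require Import spectral complex.
From mathcomp Require Import boolp classical_sets reals ereal exp.
From mathcomp Require Import ring lra zify.
Set Implicit Arguments.
Unset Strict Implicit.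
Unset Printing Implicit Defensive.
Import Order.TTheory GRing.Theory Num.Theory.

(* Prepare the phase state with amplitudes proportional to (-1)^f(x), where f is
   a quadratic form, using no ancilla and no measurement.  One vertex r of the
   graph serves as a register: f = f_E + x_r * (sum of x_w over w in L), with r
   isolated in E.  For v <> r, a CZ on (v, r) toggles v in L, while a CNOT from
   v to r substitutes x_r + x_v for x_r and so joins v to all of L at once; any
   combination of these on the same pair is a single two-qubit gate.

   Read the double occurrence word from left to right, keeping in L the letters
   that have occurred exactly once.  If r is the letter whose first occurrence
   comes last, and every v is joined to L at its first occurrence, then all
   other edges of the interval graph have been created when r is reached, and L
   is the neighbourhood of r.  This takes one gate per letter read, hence at
   most 2(n-1) gates.

   For circle graphs the register only records the letters of P, and the letters
   of D are joined to it at their second occurrence.  For a opening before b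
   this creates the edge ab iff exactly one of (a in D, b in P, abab) and
   (b in D, a in P, abba) holds.  Splitting the letters, sorted by first
   occurrence, into blocks A, B, C and taking P = B + C and D = A + B gives all
   interlacement edges between different blocks, but joins all overlapping pairs
   inside B; there the nesting edges remain to be removed.  Nesting graphs are
   treated in the same way with P = A + B and D = B + C.  One block costs 1 per
   letter and the two others 2; giving the cheap block half of the letters, the
   cost is about m log2 m for the m = n - 1 vertices other than r, and m further
   gates join r to its neighbours. *)

(** * Joining vertices through a register *)

Section Register.
Variables (n : nat) (r : 'I_n).

(* [reach k S L]: with [k] two-qubit gates one can create the edges [S] between
   the vertices other than [r], together with the edges from [r] to [L].  The
   gate at [v] joins [v] to [L] when [c] holds, and sets the membership of [v]
   in [L] to [t]. *)
Inductive reach : nat -> ('I_n -> 'I_n -> bool) -> ('I_n -> bool) -> Prop :=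
| reach_init : reach 0 (fun _ _ => false) (fun _ => false)
| reach_edge k S L a b : a != b -> a != r -> b != r -> reach k S L ->
    reach k.+1
      (fun u w => S u w (+) ((u == a) && (w == b) || (u == b) && (w == a))) L
| reach_gate k S L v (t c : bool) : v != r -> reach k S L ->
    reach k.+1
      (fun u w => S u w (+) [&& c, u != w & (u == v) && L w (+) (w == v) && L u])
      (fun w => if w == v then t else L w).

Lemma reach_ext k S L S' L' :
  S =2 S' -> L =1 L' -> reach k S L -> reach k S' L'.
Proof.
move=> eS eL; have -> : S = S' by apply/funext => u; apply/funext => w.
by have -> : L = L' by apply/funext.
Qed.

Definition active (p : seq 'I_n) (v : 'I_n) : bool := odd (count_mem v p).

Lemma active_rcons p v w : active (rcons p v) w = (v == w) (+) active p w.
Proof.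
by rewrite /active -cats1 count_cat /= addn0 oddD addbC; case: (v == w).
Qed.

(* The register holds the active letters of [P]; [Q v act] tells whether [v] is
   joined to the register at an occurrence where its activity is [act]. *)
Variables (P : pred 'I_n) (Q : 'I_n -> bool -> bool).

Fixpoint sweep (p s : seq 'I_n) (u w : 'I_n) : bool :=
  if s is v :: s' then
    [&& Q v (active p v), u != w &
        (u == v) && (P w && active p w) (+) (w == v) && (P u && active p u)]
    (+) sweep (rcons p v) s' u w
  else false.

Fixpoint sweep_cost (p s : seq 'I_n) : nat :=
  if s is v :: s' then (P v || Q v (active p v)) + sweep_cost (rcons p v) s'
  else 0.

Lemma reach_sweep k S p s : P r = false -> (forall act, Q r act = false) ->
  reach k S (fun w => P w && active p w) ->
  reach (k + sweep_cost p s) (fun u w => S u w (+) sweep p s u w)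
        (fun w => P w && active (p ++ s) w).
Proof.
move=> Pr Qr; elim: s k S p => [|v s IH] k S p.
  rewrite addn0 cats0.
  by apply: reach_ext => // u w /=; rewrite addbF.
move=> H /=.
have H1 : reach (k + (P v || Q v (active p v)))
   (fun u w => S u w (+) [&& Q v (active p v), u != w &
        (u == v) && (P w && active p w) (+) (w == v) && (P u && active p u)])
   (fun w => P w && active (rcons p v) w).
  case: (boolP (_ || _)) => [vPQ|].
    have vr : v != r by apply: contraTneq vPQ => ->; rewrite Pr Qr.
    (* Reading [v] flips its activity, so afterwards [v] belongs to the register iff it is in [P]
       and was inactive before. *)
    rewrite addn1; apply: reach_ext (reach_gate (P v && ~~ active p v)
       (Q v (active p v)) vr H) => // w /=.
    rewrite active_rcons eq_sym; case: eqP => [->|//].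
    by rewrite addTb.
  rewrite negb_or addn0 => /andP[nP nQ].
  apply: reach_ext H => [u w|w].
    by rewrite (negbTE nQ) /= addbF.
  by rewrite active_rcons; case: eqP => [<-|//]; rewrite (negbTE nP).
move: (IH _ _ _ H1); rewrite cat_rcons addnA.
by apply: reach_ext => // u w; rewrite addbA.
Qed.

Lemma active_filter (d : pred 'I_n) p u : d u ->
  active [seq x <- p | d x] u = active p u.
Proof.
move=> du; rewrite /active count_filter; congr odd; apply: eq_count => x /=.
by case: eqP => // ->; rewrite du.
Qed.

(* Whether an edge is created only depends on the order of the occurrences of
   its two ends. *)
Lemma sweep_filter (d : pred 'I_n) p s u w : d u -> d w ->
  sweep p s u w = sweep [seq x <- p | d x] [seq x <- s | d x] u w.
Proof.
move=> du dw; elim: s p => [//|v s IH] p /=.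
rewrite IH filter_rcons; case: ifPn => dv /=.
  by rewrite !active_filter.
have -> : (u == v) = false by apply: contraNF dv => /eqP <-.
have -> : (w == v) = false by apply: contraNF dv => /eqP <-.
by rewrite !andbF.
Qed.

(** A gate is charged to the letter being read, and whether it is needed depends only on the earlier
    occurrences of that letter. *)
Lemma sweep_cost_sum p s : sweep_cost p s =
  \sum_u sweep_cost [seq x <- p | x == u] [seq x <- s | x == u].
Proof.
elim: s p => [|v s IH] p /=; first by rewrite big1.
rewrite IH (bigD1 v) //= [in RHS](bigD1 v) //= eqxx /= addnA.
rewrite active_filter /= ?eqxx // filter_rcons /= eqxx; congr addn.
by apply: eq_bigr => u uv; rewrite filter_rcons /= eq_sym (negbTE uv).
Qed.

End Register.

(** * Double occurrence words *)

Section Words.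
Variables (n : nat) (m : seq 'I_n) (hm : double_occurrence_word m).

Lemma subwordC a b : subword m a b = subword m b a.
Proof. by apply: eq_filter => x; rewrite orbC. Qed.

Lemma interlacedC a b : interlaced m a b = interlaced m b a.
Proof. by rewrite /interlaced subwordC !inE orbC. Qed.

Lemma nestedC a b : nested m a b = nested m b a.
Proof. by rewrite /nested subwordC !inE orbC. Qed.

(** By counting, the subword has two letters of each kind, and it begins with [a] because [a] opens
    first. *)
Lemma subword_cases a b : a != b -> index a m < index b m ->
  subword m a b \in [:: [:: a; b; a; b]; [:: a; b; b; a]; [:: a; a; b; b]].
Proof.
move=> ab lt_ab.
have ca : count_mem a (subword m a b) = 2.
  rewrite count_filter -[RHS](hm a); apply: eq_count => x /=.
  by case: eqP.
have cb : count_mem b (subword m a b) = 2.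
  rewrite count_filter -[RHS](hm b); apply: eq_count => x /=.
  by rewrite orbC; case: eqP.
have hd : ohead (subword m a b) = Some a.
  elim: (m) lt_ab => [//|x l IH] /=; rewrite /subword /=.
  case: (x =P a) => [->//|xa]; case: (x =P b) => [//|xb] /=.
  by rewrite ltnS => /IH.
have al : all (fun x => (x == a) || (x == b)) (subword m a b).
  exact: filter_all.
have sz : size (subword m a b) = 4.
  rewrite -(count_predC (pred1 a)) ca.
  rewrite (eq_in_count (a2 := pred1 b)) ?cb // => x /(allP al) /=.
  by case: (x =P a) => [->|_ /= ->//]; rewrite (negbTE ab).
move: ca cb hd al sz.
case: (subword m a b) => [//|x1 [//|x2 [//|x3 [//|x4 [|//]]]]] /=.
move=> ca cb [e1]; subst x1; move: ca cb; rewrite eqxx (negbTE ab) /=.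
have ba : (b == a) = false by rewrite eq_sym (negbTE ab).
move=> ca cb /and4P[/orP[]/eqP e2 /orP[]/eqP e3 /orP[]/eqP e4 _] _;
subst x2 x3 x4;
by move: ca cb; rewrite ?eqxx ?ba ?(negbTE ab) ?inE ?eqxx ?orbT.
Qed.

(** Joins happen only at second occurrences. In [abab] the second [a] finds [b] active and the
    second [b] finds [a] closed; in [abba] it is the other way round; in [aabb] neither finds the
    other active. *)
Lemma sweep_pair P Q a b : a != b -> index a m < index b m ->
  (forall v, Q v false = false) ->
  sweep P Q [::] m a b =
    [&& Q a true, P b & interlaced m a b] (+) [&& Q b true, P a & nested m a b].
Proof.
move=> ab lt_ab Q0.
rewrite (@sweep_filter _ _ _ (fun x => (x == a) || (x == b))) ?eqxx ?orbT //.
rewrite -/(subword m a b) /interlaced /nested /=.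
have ba : (b == a) = false by rewrite eq_sym (negbTE ab).
have := subword_cases ab lt_ab.
rewrite !inE => /or3P[]/eqP -> /=;
  rewrite /active /= ?Q0 ?eqxx ?ab ?(negbTE ab) ?ba /=
  !eqseq_cons ?eqxx ?(negbTE ab) ?ba /= ?andbF ?andbT ?addbF ?Q0 //=.
Qed.

Lemma sweepC P Q p s (a b : 'I_n) : sweep P Q p s a b = sweep P Q p s b a.
Proof.
elim: s p => [//|v s IH] p /=.
by rewrite IH eq_sym [X in [&& _, _ & X]]addbC.
Qed.

Lemma sweepxx P Q p s (a : 'I_n) : sweep P Q p s a a = false.
Proof. by elim: s p => [//|v s IH] p /=; rewrite IH eqxx andbF. Qed.

Lemma sweep_off P Q p s (r w : 'I_n) :
  P r = false -> (forall act, Q r act = false) ->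
  sweep P Q p s r w = false.
Proof.
move=> Pr Qr; elim: s p => [//|v s IH] p /=; rewrite IH Pr andbF addbF.
by case: (eqVneq r v) => [<-|_]; rewrite ?Qr ?andbF.
Qed.

Lemma filter_double v : [seq x <- m | x == v] = [:: v; v].
Proof.
rewrite -[RHS]/(nseq 2 v) -(hm v) -size_filter.
by apply/all_pred1P; apply: filter_all.
Qed.

Lemma sweep_cost_double P Q :
  sweep_cost P Q [::] m = \sum_v ((P v || Q v false) + (P v || Q v true)).
Proof.
rewrite sweep_cost_sum; apply: eq_bigr => v _.
by rewrite filter_double /= /active /= eqxx addn0.
Qed.

Lemma mem_double v : v \in m.
Proof. by rewrite -has_pred1 has_count hm. Qed.

(** At the end of the word every letter has occurred twice, so the register is empty again and
    further sweeps can follow. *)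
Lemma reach_double (r : 'I_n) (P D : pred 'I_n) k S :
  P r = false -> D r = false -> reach r k S (fun=> false) ->
  reach r (k + \sum_v (P v + (P v || D v)))
    (fun u w => S u w (+) sweep P (fun v act => act && D v) [::] m u w)
    (fun=> false).
Proof.
move=> Pr Dr H.
have /= := @reach_sweep n r P (fun v act => act && D v) k S [::] m Pr.
rewrite sweep_cost_double Dr.
have -> : (fun w => P w && active m w) = (fun=> false).
  by apply/funext => w; rewrite /active hm andbF.
have -> : (fun w : 'I_n => P w && active [::] w) = (fun=> false).
  by apply/funext => w; rewrite andbF.
have -> : \sum_v ((P v || false && D v) + (P v || true && D v)) =
    \sum_v (P v + (P v || D v)).
  by apply: eq_bigr => v _; rewrite orbF.
by apply => //; case.
Qed.

(** * Direct constructions with one gate per edge or per vertex *)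

Lemma reach_star (r x : 'I_n) (tau : rel 'I_n) s k S L :
  x != r -> uniq (x :: s) -> r \notin s -> reach r k S L ->
  exists2 k', k' <= k + size s & reach r k' (fun u w => S u w (+)
    ((u == x) && (w \in s) && tau u w || (w == x) && (u \in s) && tau w u)) L.
Proof.
move=> xr /= /andP[xs us] rs H; elim: s us xs rs => [|y s IH] /=.
  move=> _ _ _; exists k; first by rewrite addn0.
  by apply: reach_ext H => // u w; rewrite !andbF addbF.
rewrite !inE !negb_or => /andP[ys us] /andP[xy xs] /andP[ry rs].
have [k' le_k' {}IH] := IH us xs rs.
have [txy|/negbTE txy] := boolP (tau x y).
- exists k'.+1; first by rewrite addnS ltnS.
  have yr : y != r by rewrite eq_sym.
  apply: reach_ext (reach_edge xy xr yr IH) => // u w.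
  rewrite -addbA; congr addb; rewrite !inE.
  case: (eqVneq u x) => [->|ux]; case: (eqVneq w x) => [->|wx];
    rewrite /= ?(negbTE xs) ?(negbTE xy) ?andbF ?orbF //=.
    by case: (eqVneq w y) => [->|] /=; rewrite ?txy ?(negbTE ys) ?addbF.
  by case: (eqVneq u y) => [->|] /=; rewrite ?txy ?(negbTE ys) ?addbF.
- exists k'; first by rewrite addnS; apply: leq_trans le_k' _.
  apply: reach_ext IH => // u w; congr addb; rewrite !inE.
  case: (eqVneq u x) => [->|ux]; case: (eqVneq w x) => [->|wx];
    rewrite /= ?(negbTE xs) ?(negbTE xy) ?andbF ?orbF //=.
    by case: (eqVneq w y) => [->|] /=; rewrite ?txy ?(negbTE ys).
  by case: (eqVneq u y) => [->|] /=; rewrite ?txy ?(negbTE ys).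
Qed.

(** Each edge is made by its own gate; this is the base case of the recursion, with counts doubled
    to avoid halves. *)
Lemma reach_pairs (r : 'I_n) (tau : rel 'I_n) s k S L :
  symmetric tau -> uniq s -> r \notin s -> reach r k S L ->
  exists2 k', 2 * k' <= 2 * k + size s * (size s).-1 &
    reach r k' (fun u w => S u w (+) [&& u \in s, w \in s, u != w & tau u w]) L.
Proof.
move=> tauC; elim: s k S => [|x s IH] k S.
  move=> _ _ H; exists k; first by rewrite addn0.
  by apply: reach_ext H => // u w; rewrite addbF.
move=> us; rewrite inE negb_or eq_sym => /andP[xr rs] H.
have [k1 le_k1 H1] := reach_star tau xr us rs H.
have /andP[xs us'] := us.
have [k2 le_k2 H2] := IH _ _ us' rs H1.
exists k2; first by move: le_k1 le_k2 => /=; nia.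
apply: reach_ext H2 => // u w; rewrite -addbA; congr addb.
rewrite ![_ \in x :: s]inE.
case: (eqVneq u x) => [->|ux]; case: (eqVneq w x) => [->|wx] //=;
  rewrite ?(negbTE xs) ?andbF ?orbF ?addbF ?addFb ?[x == _]eq_sym ?ux ?wx ?eqxx //=.
by rewrite tauC.
Qed.

(** A gate with [c] false only sets a membership bit, so prescribing the register on [s] takes one
    gate per letter. *)
Lemma reach_register (r : 'I_n) (g : pred 'I_n) s k S :
  r \notin s -> reach r k S (fun=> false) ->
  reach r (k + size s) S (fun w => (w \in s) && g w).
Proof.
move=> + H; elim: s => [|x s IH]; first by rewrite addn0.
rewrite inE negb_or eq_sym => /andP[xr rs]; rewrite /= addnS.
apply: reach_ext (reach_gate (g x) false xr (IH rs)) => [u w|w] /=.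
  by rewrite addbF.
by rewrite inE; case: eqP => [->|].
Qed.

(* Up to [capacity t] letters can be treated with at most [t / 2] gates per
   letter.  In the recursion the block costing 1 per letter has [capacity t.+2]
   letters, and the two blocks costing 2 per letter have [capacity t]. *)
Fixpoint capacity t : nat :=
  match t with
  | 0 => 1 | 1 => 2 | 2 => 3 | 3 => 4
  | ((t0.+2) as t2).+2 => capacity t2 + 2 * capacity t0
  end.

Lemma capacity_rec t : capacity t.+4 = capacity t.+2 + 2 * capacity t.
Proof. by []. Qed.

(** * The three-block recursion for circle graphs *)

Lemma split3 (s : seq 'I_n) x y z : size s <= x + y + z -> exists A B C,
  [/\ s = A ++ B ++ C, size A <= x, size B <= y & size C <= z].
Proof.
move=> le_s; exists (take x s), (take y (drop x s)), (drop y (drop x s)).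
by split; rewrite ?cat_take_drop ?size_take_min ?size_drop ?geq_minl //; lia.
Qed.

(** The flag lets one induction treat interlacement and nesting graphs together, since each needs
    the other on its middle block. *)
Definition interlaced_if c a b := if c then interlaced m a b else nested m a b.

Lemma interlaced_ifC c : symmetric (interlaced_if c).
Proof. by move=> a b; rewrite /interlaced_if interlacedC nestedC. Qed.

Lemma sum_mem (s : seq 'I_n) : uniq s -> \sum_v (v \in s) = size s.
Proof. move=> us; rewrite -(card_uniqP us) -sum1_card [RHS]big_mkcond.
by apply: eq_bigr => v _; case: (v \in s). Qed.

Definition before a b := index a m < index b m.

Lemma before_uniq s : pairwise before s -> uniq s.
Proof. by apply: pairwise_uniq => x; rewrite /before ltnn. Qed.

Lemma reach_interlaced_if (r : 'I_n) t s c k S :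
  pairwise before s -> r \notin s -> size s <= capacity t ->
  reach r k S (fun=> false) ->
  exists2 k', 2 * k' <= 2 * k + t * size s &
    reach r k'
      (fun u w => S u w (+) [&& u \in s, w \in s, u != w & interlaced_if c u w])
      (fun=> false).
Proof.
have [t' le_t] := ubnP t; elim: t' => // t' IH in t le_t s c k S *.
move=> s_m rs le_s H; have us := before_uniq s_m.
have [lt_t|ge_t] := ltnP t 4.
  have [k' le_k' H'] := reach_pairs (interlaced_ifC c) us rs H; exists k' => //.
  (* For [t < 4] the capacity is at most [t + 1], so a letter has at most [t] partners, that is at
     most [t / 2] edges per letter. *)
  apply: leq_trans le_k' _; rewrite leq_add2l mulnC leq_mul2r.
  have : capacity t <= t.+1 by case: t lt_t {le_t le_s} => [|[|[|[|]]]].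
  lia.
have [t0 def_t] : exists t0, t = t0.+4 by exists (t - 4); lia.
subst t; move: le_s; rewrite capacity_rec => le_s.
(* The cheap block consists of the letters in [D] but not in [P], which need a gate only at their
   second occurrence: it is [A] for interlacement and [C] for nesting. *)
have [A [B [C [def_s le_A le_B le_C]]]] : exists A B C,
   [/\ s = A ++ B ++ C, size A <= capacity (if c then t0.+2 else t0),
     size B <= capacity t0 & size C <= capacity (if c then t0 else t0.+2)].
  apply: split3; apply: leq_trans le_s _; case: (c);
    move: (capacity t0.+2) (capacity t0) => x y; lia.
subst s; move: s_m rs us.
rewrite !pairwise_cat !allrel_catr => /and3P[/andP[AB AC] sA /and3P[BC sB sC]].
rewrite !mem_cat !negb_or => /and3P[rA rB rC] us.
pose P : pred 'I_n :=
  fun v => if c then (v \in B) || (v \in C) else (v \in A) || (v \in B).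
pose D : pred 'I_n :=
  fun v => if c then (v \in A) || (v \in B) else (v \in B) || (v \in C).
have Pr : P r = false.
  by rewrite /P; case: (c); rewrite ?(negbTE rA) ?(negbTE rB) ?(negbTE rC).
have Dr : D r = false.
  by rewrite /D; case: (c); rewrite ?(negbTE rA) ?(negbTE rB) ?(negbTE rC).
have H0 := reach_double Pr Dr H.
have cost : \sum_v (P v + (P v || D v)) <=
    (if c then size A else 2 * size A) + 2 * size B +
    (if c then 2 * size C else size C).
  have [uA uB uC] : [/\ uniq A, uniq B & uniq C] by rewrite !before_uniq.
  have -> : (if c then size A else 2 * size A) + 2 * size B +
      (if c then 2 * size C else size C) =
    \sum_v ((if c then 1 else 2) * (v \in A) + 2 * (v \in B) +
            (if c then 2 else 1) * (v \in C)).
    rewrite !big_split /= -!big_distrr /= !sum_mem // big1_eq addn0 addnn -mul2n.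
    by case: (c); rewrite ?mul1n.
  apply: leq_sum => v _; rewrite /P /D.
  by case: (c); case: (v \in A); case: (v \in B); case: (v \in C).
(* Inside [A] or [C] the sweep makes no edge, as [P] or [D] is void there. Inside [B] it makes the
   interlaced and the nested pairs, so adding the graph of [~~ c] cancels the unwanted ones. Sweep
   and recursion together cost at most [t0.+4 / 2] per letter in each block. *)
have [|k1 le1 H1] := IH _ _ A c _ _ sA rA le_A H0;
  first by move: le_t; clear; case: c; lia.
have [|k2 le2 H2] := IH _ _ B (~~ c) _ _ sB rB le_B H1;
  first by move: le_t; clear; lia.
have [|k3 le3 H3] := IH _ _ C c _ _ sC rC le_C H2;
  first by move: le_t; clear; case: c; lia.
exists k3.
  rewrite !size_cat; move: le1 le2 le3 cost.
  move: (\sum_v _) (size A) (size B) (size C) => N a b d.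
  by clear; case: c => /=; lia.
apply: reach_ext H3 => // u w; rewrite -!addbA; congr addb.
have disj v : [/\ ~~ ((v \in A) && (v \in B)), ~~ ((v \in A) && (v \in C))
   & ~~ ((v \in B) && (v \in C))].
  split; apply/negP => /andP[v1 v2].
  - by have := allrelP AB _ _ v1 v2; rewrite /before ltnn.
  - by have := allrelP AC _ _ v1 v2; rewrite /before ltnn.
  - by have := allrelP BC _ _ v1 v2; rewrite /before ltnn.
wlog lt_uw : u w / before u w => [hw|].
  have [lt_uw|lt_wu|eq_uw] := ltngtP (index u m) (index w m).
  - exact: hw.
  - rewrite sweepC [u == w]eq_sym ![interlaced_if _ u w]interlaced_ifC.
    rewrite ![(u \in _) && [&& w \in _, _ & _]]andbCA; exact: hw.
  - have -> : u = w by apply: (index_inj u _ _ eq_uw); apply: mem_double.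
    by rewrite sweepxx eqxx !andbF.
have uw : u != w by apply: contraTneq lt_uw => ->; rewrite /before ltnn.
have order X Y : allrel before X Y -> ~~ ((w \in X) && (u \in Y)).
  move=> XY; apply/negP => /andP[wX uY].
  by have := allrelP XY _ _ wX uY; rewrite /before ltnNge (ltnW lt_uw).
rewrite sweep_pair // uw !mem_cat /P /D /interlaced_if.
move: (order _ _ AB) (order _ _ AC) (order _ _ BC) (disj u) (disj w).
clear; case: c; move: (u \in A) (u \in B) (u \in C) (w \in A) (w \in B)
  (w \in C) (interlaced m u w) (nested m u w);
by do 8![case=> //=] => _ _ _ [] // ? ? ? [].
Qed.

(** * Growth of [capacity] *)

Lemma capacity_gt t : t < capacity t.
Proof.
have [t' le_t] := ubnP t; elim: t' t le_t => // t' IH [|[|[|[|t]]]] // le_t.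
rewrite capacity_rec.
have := IH t.+2 ltac:(lia); have := IH t ltac:(lia); lia.
Qed.

(** By the recurrence, the deviation [capacity t.+2 - 2 * capacity t] changes sign when [t] grows by
    2; it is 1 at [t = 0] and 0 at [t = 1]. *)
Lemma capacity_double t :
  2 * capacity t <= (capacity t.+2).+1 /\ capacity t.+2 <= (2 * capacity t).+1.
Proof.
have [t' le_t] := ubnP t; elim: t' t le_t => // t' IH [|[|t]] // le_t.
by have := IH t ltac:(lia); rewrite capacity_rec; lia.
Qed.

Lemma capacity_ge t : 4 ^ t.+3 <= (capacity t + 3) ^ 5.
Proof.
have [t' le_t] := ubnP t; elim: t' t le_t => // t' IH t le_t.
have [t_le|t_ge] := leqP t 13.
  by move: t t_le {le_t}; do 14?[case=> [_|]]; rewrite ?[capacity _]/=; lia.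
have [t0 def_t] : exists t0, t = t0.+2 by exists (t - 2); lia.
subst t; have := IH t0 ltac:(lia); have [+ _] := capacity_double t0.
have := capacity_gt t0.
move: (capacity t0.+2) (capacity t0) => x y lt_y le_x.
(* Since [(7/4)^5 > 16], growth of [capacity + 3] by [7/4] pays for a step of 2 in [t]. With
   [x >= 2 * y - 1] this needs [y >= 13], hence the direct check up to [t = 13]. *)
have : 7 * (y + 3) <= 4 * (x + 3) by lia.
rewrite -(leq_exp2r _ _ (isT : 0 < 5)) !expnMn.
rewrite [4 ^ t0.+2.+3](expnD 4 2 t0.+3).
move: (4 ^ t0.+3) ((x + 3) ^ 5) ((y + 3) ^ 5) => a b c.
lia.
Qed.

(** For the least suitable [t > 0], [N] exceeds the capacity of its predecessor, so [N + 2] is at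
    least that capacity plus 3. *)
Lemma capacity_choose N : 0 < N ->
  exists2 t, N <= capacity t & 4 ^ t.+2 <= (N + 2) ^ 5.
Proof.
move=> N0; have ex : exists t, N <= capacity t.
  by exists N; apply/ltnW/capacity_gt.
have [[|t] le_N min_t] := ex_minnP ex; [exists 0 => //|exists t.+1 => //].
  by apply: (@leq_trans (3 ^ 5)); [lia|rewrite leq_exp2r //; lia].
apply: leq_trans (capacity_ge t) _; rewrite leq_exp2r //.
have : ~~ (N <= capacity t) by apply/negP => /min_t; rewrite ltnn.
lia.
Qed.

(** The recursion starts and ends with an empty register; the extra 2 in [t.+2] pays for the final
    gate per vertex that joins [r] to its neighbours. *)
Lemma reach_circle (r : 'I_n) t : n.-1 <= capacity t ->
  exists2 k, 2 * k <= t.+2 * n.-1 &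
    reach r k (fun u w => [&& u != r, w != r, u != w & interlaced m u w])
      (fun w => (w != r) && interlaced m r w).
Proof.
pose s := sort (relpre (index ^~ m) leq) (rem r (enum 'I_n)) => le_n.
have us : uniq s by rewrite sort_uniq rem_uniq // enum_uniq.
have mem_s v : (v \in s) = (v != r).
  by rewrite mem_sort mem_rem_uniq ?enum_uniq // !inE mem_enum andbT.
have sz : size s = n.-1 by rewrite size_sort size_rem ?mem_enum // size_enum_ord.
have s_m : pairwise before s.
  have : pairwise [rel a b | (index a m <= index b m) && (a != b)] s.
    rewrite pairwise_relI -uniq_pairwise us andbT -sorted_pairwise.
      by apply: sort_sorted => a b; apply: leq_total.
    by move=> a b c /=; apply: leq_trans.
  apply: sub_pairwise => a b /= /andP[le_ab ab].
  rewrite /before ltn_neqAle le_ab andbT; apply: contraNneq ab => eq_ab.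
  by apply/eqP; apply: (index_inj a _ _ eq_ab); apply: mem_double.
have rs : r \notin s by rewrite mem_s eqxx.
rewrite -sz in le_n *.
have [k le_k H] := reach_interlaced_if true s_m rs le_n (reach_init r).
exists (k + size s); first by move: le_k; rewrite muln0 add0n; lia.
apply: reach_ext (reach_register (interlaced m r) rs H) => [u w|w] /=.
  by rewrite !mem_s.
by rewrite mem_s.
Qed.

(** * Interval graphs from a single sweep *)

Lemma sweep_cost_cat (P : pred 'I_n) Q p s1 s2 :
  sweep_cost P Q p (s1 ++ s2) =
  sweep_cost P Q p s1 + sweep_cost P Q (p ++ s1) s2.
Proof.
elim: s1 p => [|v s1 IH] p /=; first by rewrite cats0.
by rewrite IH cat_rcons addnA.
Qed.

Lemma filter_take_index (d : pred 'I_n) s r : d r ->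
  [seq x <- take (index r s) s | d x] =
  take (index r [seq x <- s | d x]) [seq x <- s | d x].
Proof.
move=> dr; elim: s => [//|x s IH] /=; case: (x =P r) => [->|xr].
  by rewrite dr /= eqxx.
by rewrite /= IH; case: (d x) => //=; case: (x =P r).
Qed.

(** Joins happen only at first occurrences, so the pair is decided when [b] opens, which the prefix
    includes: [a] is then active iff the pattern is [abab] or [abba]. *)
Lemma sweep_prefix (P : pred 'I_n) Q k a b :
  a != b -> index a m < index b m < k ->
  P a -> P b -> Q a =1 negb -> Q b =1 negb ->
  sweep P Q [::] (take k m) a b = nested m a b || interlaced m a b.
Proof.
move=> ab /andP[lt_ab lt_bk] Pa Pb Qa Qb.
pose d x := (x == a) || (x == b).
have [da db] : d a /\ d b by rewrite /d !eqxx orbT.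
rewrite (sweep_filter _ _ _ _ da db).
have [j def_j] : exists j, [seq x <- take k m | d x] = take j (subword m a b).
  exists (size [seq x <- take k m | d x]).
  have -> : subword m a b =
      [seq x <- take k m | d x] ++ [seq x <- drop k m | d x].
    by rewrite -filter_cat cat_take_drop.
  by rewrite take_size_cat.
have : b \in take j (subword m a b).
  by rewrite -def_j mem_filter db in_take ?mem_double.
rewrite def_j /interlaced /nested /=.
have ba : (b == a) = false by rewrite eq_sym (negbTE ab).
have := subword_cases ab lt_ab.
rewrite !inE => /or3P[]/eqP -> /=; case: j {def_j} => [|[|[|[|j]]]] /=;
  by rewrite /active /= ?inE ?Qa ?Qb ?Pa ?Pb ?eqxx ?ab ?(negbTE ab) ?ba /=
  ?eqseq_cons ?eqxx ?(negbTE ab) ?ba /= ?Qa ?Qb.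
Qed.

(** Before the first [r], the letter [a] has occurred once or twice, and only once iff its second
    occurrence comes after that [r]. *)
Lemma active_prefix a r : a != r -> index a m < index r m ->
  active (take (index r m) m) a = nested m r a || interlaced m r a.
Proof.
move=> ar lt_ar; pose d x := (x == a) || (x == r).
have [da dr] : d a /\ d r by rewrite /d !eqxx orbT.
rewrite -(active_filter _ da) filter_take_index // nestedC interlacedC.
rewrite -/(subword m a r) /interlaced /nested.
have ra : (r == a) = false by rewrite eq_sym (negbTE ar).
have := subword_cases ar lt_ar.
rewrite !inE => /or3P[]/eqP -> /=;
  by rewrite /active /= ?eqxx ?(negbTE ar) ?ra /= ?eqxx ?(negbTE ar) ?ra
  ?eqseq_cons ?eqxx ?(negbTE ar) ?ra /= ?eqxx ?(negbTE ar) ?ra.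
Qed.

Lemma reach_interval (r : 'I_n) : (forall v, index v m <= index r m) ->
  exists2 k, k <= 2 * n.-1 &
    reach r k
      (fun u w => [&& u != r, w != r, u != w & nested m u w || interlaced m u w])
      (fun w => (w != r) && (nested m r w || interlaced m r w)).
Proof.
move=> r_max.
pose P : pred 'I_n := fun v => v != r.
pose Q (v : 'I_n) act := (v != r) && ~~ act.
have lt_r v : v != r -> index v m < index r m.
  move=> vr; rewrite ltn_neqAle r_max andbT; apply: contraNneq vr => eq_v.
  by apply/eqP; apply: (index_inj v _ _ eq_v); apply: mem_double.
have Pr : P r = false by rewrite /P eqxx.
have Qr act : Q r act = false by rewrite /Q eqxx.
exists (sweep_cost P Q [::] (take (index r m) m)).
  (* A sweep of the whole word would use one gate at each of the two occurrences of every letter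
     other than [r]; stopping at [r] only saves gates. *)
  have -> : 2 * n.-1 = sweep_cost P Q [::] m.
    rewrite sweep_cost_double (bigD1 r) //= Pr !Qr.
    rewrite (eq_bigr (fun=> 2)) => [|v vr]; last by rewrite /P /Q vr.
    rewrite sum_nat_const cardC1 card_ord; lia.
  by rewrite -[in leqRHS](cat_take_drop (index r m) m) sweep_cost_cat leq_addr.
have := @reach_sweep n r P Q 0 (fun _ _ => false) [::] (take (index r m) m) Pr Qr.
have -> : (fun w => P w && active [::] w) = (fun=> false).
  by apply/funext => w; rewrite andbF.
move=> /(_ (reach_init r)); rewrite add0n.
apply: reach_ext => [u w|w] /=; last first.
  by rewrite /P; case: eqVneq => //= wr; rewrite active_prefix ?lt_r.
case: (eqVneq u r) => [->|ur] /=; first exact: sweep_off.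
case: (eqVneq w r) => [->|wr] /=; first by rewrite sweepC sweep_off.
wlog lt_uw : u w ur wr / before u w => [hw|].
  have [lt_uw|lt_wu|eq_uw] := ltngtP (index u m) (index w m).
  - exact: hw.
  - by rewrite sweepC eq_sym nestedC interlacedC; apply: hw.
  - have -> : u = w by apply: (index_inj u _ _ eq_uw); apply: mem_double.
    by rewrite sweepxx eqxx.
have uw : u != w by apply: contraTneq lt_uw => ->; rewrite /before ltnn.
have lt_uwr : index u m < index w m < index r m by rewrite lt_r // andbT.
by rewrite uw /=; apply: sweep_prefix => // act; rewrite /Q ?ur ?wr.
Qed.
End Words.

Local Open Scope ring_scope.
Local Open Scope sesquilinear_scope.
Local Open Scope classical_set_scope.

(** * Arithmetic of bits modulo 2 *)

Lemma bit_cases (x : 'I_2) : x = 0 \/ x = 1.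
Proof. by case: x => [[|[|//]] i]; [left|right]; apply: val_inj. Qed.

Lemma bit_addxx (x : 'I_2) : x + x = 0.
Proof. by have [->|->] := bit_cases x; apply: val_inj. Qed.

Lemma bit_opp (x : 'I_2) : - x = x.
Proof. by apply/eqP; rewrite eq_sym -addr_eq0 bit_addxx. Qed.

Lemma bits_addxx k (x : bits k) : x + x = 0.
Proof. by apply/ffunP => j; rewrite !ffunE bit_addxx. Qed.

Lemma bits_addK k (a x : bits k) : x + a + a = x.
Proof. by rewrite -addrA bits_addxx addr0. Qed.

(** * Clifford operators *)

Section Operators.
Variable R : realType.
Local Notation C := R[i].
Local Notation operator := (operator R).
Local Notation state := (state R).

Definition sg (e : 'I_2) : C := (-1) ^+ e.

Lemma sgD e f : sg (e + f) = sg e * sg f.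
Proof.
by have [->|->] := bit_cases e; have [->|->] := bit_cases f;
  rewrite /sg /= ?expr1 ?expr0 ?mul1r ?mulr1 ?mulrNN ?mulr1.
Qed.

Lemma sg0 : sg 0 = 1. Proof. by []. Qed.

Lemma sg_mulxx e : sg e * sg e = 1.
Proof. by rewrite -sgD bit_addxx. Qed.

Lemma sg_sum (I : finType) (F : I -> 'I_2) : sg (\sum_i F i) = \prod_i sg (F i).
Proof. by apply: (big_morph sg sgD). Qed.

Lemma sg_conj e : (sg e)^* = sg e.
Proof. by rewrite /sg rmorphXn /= rmorphN1. Qed.

Section Qubits.
Variable n : nat.

Lemma entry_mx_of F x y : entry (mx_of F : operator n) x y = F x y.
Proof. by rewrite /entry mxE !enum_rankK. Qed.

Lemma amp_state_of f x : amp (state_of f : state n) x = f x.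
Proof. by rewrite /amp mxE enum_rankK. Qed.

Lemma operatorP (A B : operator n) :
  (forall x y, entry A x y = entry B x y) -> A = B.
Proof.
move=> eqAB; apply/matrixP => i j.
by have := eqAB (enum_val i) (enum_val j); rewrite /entry !enum_valK.
Qed.

Lemma stateP (f g : state n) : (forall x, amp f x = amp g x) -> f = g.
Proof.
move=> eqfg; apply/matrixP => i j; rewrite ord1.
by have := eqfg (enum_val i); rewrite /amp !enum_valK.
Qed.

Lemma entry_mulmx (A B : operator n) x y :
  entry (A *m B) x y = \sum_z entry A x z * entry B z y.
Proof.
by rewrite /entry mxE (reindex enum_rank) //; apply/onW_bij/enum_rank_bij.
Qed.

Lemma amp_mulmx (A : operator n) psi x :
  amp (A *m psi) x = \sum_z entry A x z * amp psi z.
Proof.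
by rewrite /amp mxE (reindex enum_rank) //; apply/onW_bij/enum_rank_bij.
Qed.

Lemma entryZ c (A : operator n) x y : entry (c *: A) x y = c * entry A x y.
Proof. by rewrite /entry mxE. Qed.

Lemma entry1 x y : entry (1%:M : operator n) x y = (x == y)%:R.
Proof. by rewrite /entry mxE (inj_eq enum_rank_inj). Qed.

Lemma entry_adj (A : operator n) x y : entry (A^t*) x y = (entry A y x)^*.
Proof. by rewrite /entry !mxE. Qed.

(* Monomial operators with entries 0, 1 and -1. *)
Definition mono (pi : bits n -> bits n) (p : bits n -> 'I_2) : operator n :=
  mx_of (fun x y => sg (p x) * (y == pi x)%:R).

Lemma entry_mono pi p x y : entry (mono pi p) x y = sg (p x) * (y == pi x)%:R.
Proof. exact: entry_mx_of. Qed.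

Lemma eq_mono pi p pi' p' : pi =1 pi' -> p =1 p' -> mono pi p = mono pi' p'.
Proof. by move=> e1 e2; apply: operatorP => x y; rewrite !entry_mono e1 e2. Qed.

Lemma sum_delta (F : bits n -> C) y : \sum_z F z * (z == y)%:R = F y.
Proof.
rewrite (bigD1 y) //= eqxx mulr1 big1 ?addr0 // => z /negbTE ->.
by rewrite mulr0.
Qed.

Lemma amp_mono pi p psi x : amp (mono pi p *m psi) x = sg (p x) * amp psi (pi x).
Proof.
rewrite amp_mulmx -(sum_delta (fun z => sg (p x) * amp psi z)).
by apply: eq_bigr => z _; rewrite entry_mono mulrAC.
Qed.

Lemma mul_mono pi p pi' p' :
  mono pi p *m mono pi' p' = mono (pi' \o pi) (fun x => p x + p' (pi x)).
Proof.
apply: operatorP => x y; rewrite entry_mulmx entry_mono sgD.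
rewrite -(sum_delta (fun z => sg (p x) * sg (p' z) * (y == pi' z)%:R)).
by apply: eq_bigr => z _; rewrite !entry_mono; ring.
Qed.

Lemma mono_adj pi p : involutive pi -> (forall x, p (pi x) = p x) ->
  (mono pi p)^t* = mono pi p.
Proof.
move=> piK ppi; apply: operatorP => x y; rewrite entry_adj !entry_mono.
rewrite rmorphM rmorph_nat /= sg_conj.
have -> : (x == pi y) = (y == pi x) by rewrite eq_sym (can2_eq piK piK).
by case: eqP => [->|]; rewrite ?ppi ?mulr0.
Qed.

Lemma mono_id : mono id (fun=> 0) = 1%:M.
Proof. by apply: operatorP => x y; rewrite entry_mono entry1 mul1r eq_sym. Qed.

Definition dot (b x : bits n) : 'I_2 := \sum_j b j * x j.

Definition pauli (a b : bits n) : operator n := mono (fun x => x + a) (dot b).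

(* [pauli1 a b] is the Pauli matrix proportional to [Z^b X^a]; [pauli a b] is
   the tensor product of the matrices [Z^(b j) X^(a j)]. *)
Definition pauli1 (a b : 'I_2) : 'M[C]_2 :=
  if a == 0 then if b == 0 then 1%:M else pauliZ R
  else if b == 0 then pauliX R else pauliY R.

(** The power of ['i%C] matters only for Y, where it turns [Y = iXZ] into [-XZ = ZX]. *)
Lemma pauli1E (a b x y : 'I_2) :
  'i%C ^+ ((a : nat) * b) * pauli1 a b x y = sg (b * x) * (y == x + a)%:R.
Proof.
rewrite /pauli1 /sg; have [->|->] := bit_cases a; have [->|->] := bit_cases b;
have [->|->] := bit_cases x; have [->|->] := bit_cases y;
  rewrite /= ?mxE /= ?big_ord_recl ?big_ord0 ?mxE /= ?(modn_small (isT : 1 < 2)%N)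
    ?mul0n ?muln0 ?mul1n ?mod0n ?modn_small ?expr0 ?expr1 //; try ring.
all: rewrite ?mxE /= ?expr0 ?expr1 -?[(1 %% 2)%N]/1%N ?expr1 ?expr0
   ?mul0r ?mulr0 ?mul1r ?mulr1 ?addr0 ?add0r ?mul0r ?mulr0 ?mul1r ?mulr1 ?mulrN1
   ?mulrN ?add0r ?addr0 -?expr2 ?sqr_i ?opprK //.
Qed.

Lemma exp_i_mem k : 'i%C ^+ k \in [:: 1; -1; 'i%C; - 'i%C : C].
Proof.
elim: k => [|k]; first by rewrite inE eqxx.
rewrite exprS !inE => /or4P[] /eqP ->; rewrite ?mulr1 ?mulrN1 ?mulrN -?expr2 ?sqr_i ?opprK
  eqxx ?orbT //.
Qed.

Lemma tensor_pauli1 (a b : bits n) :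
  'i%C ^+ (\sum_j (a j : nat) * b j) *: tensor (fun j => pauli1 (a j) (b j)) =
  pauli a b.
Proof.
apply: operatorP => x y; rewrite entryZ entry_mono entry_mx_of expr_sum -big_split /=.
under eq_bigr do rewrite pauli1E.
rewrite big_split /= -sg_sum; congr (_ * _).
case: eqP => [->|/eqP neq]; first by rewrite big1 // => j _; rewrite ffunE eqxx.
have [j yj] : exists j, y j != (x + a) j.
  apply/existsP; apply: contraR neq; rewrite negb_exists => /forallP eq_y.
  by apply/eqP/ffunP => j; apply/eqP; move: (eq_y j); rewrite negbK.
by rewrite (bigD1 j) //=; move: yj; rewrite ffunE => /negbTE ->; rewrite mul0r.
Qed.

Lemma pauli_groupP (P : operator n) :
  pauli_group P <-> exists k a b, P = 'i%C ^+ k *: pauli a b.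
Proof.
split=> [[alpha [h [alphaP hP ->]]]|[k [a [b ->]]]].
  have /choice[ab h_ab] : forall j, exists ab : 'I_2 * 'I_2, h j = pauli1 ab.1 ab.2.
    move=> j; move: (hP j); rewrite !inE => /or4P[] /eqP ->.
    - by exists (0, 0).
    - by exists (1, 0).
    - by exists (1, 1).
    - by exists (0, 1).
  pose a : bits n := [ffun j => (ab j).1]; pose b : bits n := [ffun j => (ab j).2].
  have -> : tensor h = tensor (fun j => pauli1 (a j) (b j)).
    by congr tensor; apply/funext => j; rewrite !ffunE.
  have [k ->] : exists k, alpha = 'i%C ^+ k.
    move: alphaP; rewrite !inE => /or4P[] /eqP ->.
    - by exists 0%N.
    - by exists 2%N; rewrite sqr_i.
    - by exists 1%N.
    - by exists 3%N; rewrite exprSr sqr_i mulN1r.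
  set N := (\sum_j (a j : nat) * b j)%N.
  (* [3 * N] inverts the factor ['i%C ^+ N] of [tensor_pauli1], because the fourth power of ['i%C]
     is 1. *)
  exists (k + 3 * N)%N, a, b; rewrite -tensor_pauli1 scalerA -/N -exprD.
  rewrite -addnA -[X in (_ + (_ + X))%N]mul1n -mulnDl.
  rewrite exprD exprM (exprM _ 2 2 : _ ^+ (3 + 1) = _) sqr_i sqrrN expr1n expr1n mulr1 //.
exists ('i%C ^+ (k + \sum_j (a j : nat) * b j)), (fun j => pauli1 (a j) (b j)).
split; first exact: exp_i_mem.
  move=> j; rewrite /pauli1 !inE; case: ifP; case: ifP; rewrite eqxx ?orbT //.
by rewrite exprD -scalerA tensor_pauli1.
Qed.

(** Conjugation by a self-adjoint involution is its own inverse, so mapping the Pauli group into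
    itself already gives equality. *)
Lemma cliffordP (U : operator n) : U^t* = U -> U *m U = 1%:M ->
  (forall a b, exists k a' b', U *m pauli a b *m U = 'i%C ^+ k *: pauli a' b') ->
  clifford U.
Proof.
move=> Uadj UU Upauli.
have stable P : pauli_group P -> pauli_group (U *m P *m U).
  move=> /pauli_groupP[k [a [b ->]]]; have [k' [a' [b' E]]] := Upauli a b.
  apply/pauli_groupP; exists (k + k')%N, a', b'.
  by rewrite -scalemxAr -scalemxAl E scalerA exprD.
split; first by apply/unitarymxP; rewrite Uadj.
rewrite Uadj; apply/seteqP; split => [_ [P PP <-]|P PP]; first exact: stable.
exists (U *m P *m U); first exact: stable.
by rewrite !mulmxA UU mul1mx -mulmxA UU mulmx1.
Qed.

Lemma clifford_mul (U V : operator n) :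
  clifford U -> clifford V -> clifford (U *m V).
Proof.
move=> [uU imU] [uV imV]; split.
  exact: (@mul_unitarymx _ _ _ _ U V uU uV).
have E P : U *m V *m P *m (U *m V)^t* = U *m (V *m P *m V^t*) *m U^t*.
  by rewrite trmx_mul map_mxM /= !mulmxA.
apply/seteqP; split => [_ [P PP <-]|Q].
  by rewrite E -imU; exists (V *m P *m V^t*) => //; rewrite -imV; exists P.
by rewrite -{1}imU => -[P]; rewrite -{1}imV => -[P' PP' <-] <-; exists P'.
Qed.

Lemma sg_exp e : sg e = 'i%C ^+ (2 * (e : nat)).
Proof. by rewrite exprM sqr_i. Qed.

Lemma monoDl c pi p :
  mono pi (fun x => c + p x) = 'i%C ^+ (2 * (c : nat)) *: mono pi p.
Proof.
by apply: operatorP => x y; rewrite entryZ !entry_mono -sg_exp sgD mulrA.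
Qed.

End Qubits.

Lemma dot2 (b x : bits 2) : dot b x = b 0 * x 0 + b 1 * x 1.
Proof.
rewrite /dot !big_ord_recl big_ord0 addr0.
by have -> : lift ord0 ord0 = 1 :> 'I_2 by apply: val_inj.
Qed.

Definition cz (t : 'I_2) : operator 2 := mono id (fun x => t * x 0 * x 1).

Definition cnot_bits (c : 'I_2) (x : bits 2) : bits 2 :=
  [ffun j => if j == 1 then x 1 + c * x 0 else x 0].

Definition cnot (c : 'I_2) : operator 2 := mono (cnot_bits c) (fun=> 0).

Lemma bits2P (x y : bits 2) : x 0 = y 0 -> x 1 = y 1 -> x = y.
Proof. by move=> e0 e1; apply/ffunP => j; have [->|->] := bit_cases j. Qed.

Lemma cnot_bitsK c : involutive (cnot_bits c).
Proof.
by move=> x; apply: bits2P; rewrite !ffunE //= -addrA bit_addxx addr0.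
Qed.

Lemma clifford_cz t : clifford (cz t).
Proof.
apply: cliffordP => [||a b]; first exact: mono_adj.
  rewrite mul_mono -mono_id; apply: eq_mono => // x.
  exact: bit_addxx.
(* Expand [t * (x 0 + a 0) * (x 1 + a 1)]: the linear terms are the new Z factors, each X putting a
   Z on the other qubit, and the constant term is the sign. *)
exists (2 * ((t * a 0 * a 1)%R : nat))%N, a,
  [ffun j => b j + t * (if j == 0 then a 1 else a 0)].
rewrite !mul_mono -monoDl; apply: eq_mono => // x /=.
rewrite !dot2 !ffunE /=.
(* Each [cz] contributes [t * x 0 * x 1]. The pair vanishes modulo 2; written on the right as well,
   it makes the identity hold in any commutative ring. *)
rewrite -[RHS]addr0 -[X in _ = _ + X](bit_addxx (t * x 0 * x 1)); ring.
Qed.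

Lemma clifford_cnot c : clifford (cnot c).
Proof.
apply: cliffordP => [||a b]; first exact: (mono_adj (cnot_bitsK c)).
  rewrite mul_mono -mono_id; apply: eq_mono => x; last by rewrite addr0.
  exact: cnot_bitsK.
(* X spreads from the control 0 to the target 1, and Z from the target back to the control. *)
exists 0%N, (cnot_bits c a), [ffun j => b j + (if j == 0 then c * b 1 else 0)].
rewrite !mul_mono expr0 scale1r; apply: eq_mono => x /=.
  rewrite -[in RHS](cnot_bitsK c x); apply: bits2P; rewrite !ffunE //=; ring.
by rewrite !dot2 !ffunE /=; ring.
Qed.

(* Qubit 0 is the vertex and qubit 1 the register; [cz s] takes the vertex out
   of the register before the [cnot], so that it is not joined to itself. *)
Definition pair_gate (c s t : 'I_2) : operator 2 := cz t *m cnot c *m cz s.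

Lemma clifford_pair_gate c s t : clifford (pair_gate c s t).
Proof.
apply: clifford_mul (clifford_cz s); apply: clifford_mul (clifford_cnot c).
exact: clifford_cz.
Qed.

Lemma pair_gateE c s t : pair_gate c s t =
  mono (cnot_bits c) (fun x => t * x 0 * x 1 + s * x 0 * (x 1 + c * x 0)).
Proof.
by rewrite /pair_gate !mul_mono; apply: eq_mono => // x; rewrite !ffunE /= addr0.
Qed.

Definition rsqrt2 : C := (sqrtC 2)^-1.

Lemma rsqrt2_sqr : rsqrt2 * rsqrt2 = 2^-1.
Proof. by rewrite -expr2 exprVn sqrtCK. Qed.

Lemma rsqrt2_conj : rsqrt2^* = rsqrt2.
Proof.
by apply/CrealP; rewrite realV ger0_real // sqrtC_ge0 ler0n.
Qed.

Definition hadamard : operator 1 := mx_of (fun x y => rsqrt2 * sg (x 0 * y 0)).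

Lemma sum_bits1 (F : bits 1 -> C) :
  \sum_x F x = F [ffun=> 0] + F [ffun=> 1].
Proof.
rewrite (reindex (fun e : 'I_2 => [ffun=> e] : bits 1)) /=; last first.
  exists (fun x => x 0) => [e _|x _]; first by rewrite ffunE.
  by apply/ffunP => j; rewrite ffunE ord1.
rewrite !big_ord_recl big_ord0 addr0.
by have -> : lift ord0 ord0 = 1 :> 'I_2 by apply: val_inj.
Qed.

Lemma dot1 (b x : bits 1) : dot b x = b 0 * x 0.
Proof. by rewrite /dot big_ord1. Qed.

Lemma sum_sg (e : 'I_2) : sg 0 + sg e = 2 * (e == 0)%:R.
Proof.
by have [->|->] := bit_cases e;
  rewrite /sg /= ?expr0 ?expr1 ?subrr ?mulr0 ?mulr1.
Qed.

Lemma bits1_eq (x y : bits 1) : (x == y) = (x 0 == y 0).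
Proof.
apply/eqP/eqP => [->//|e]; by apply/ffunP => j; rewrite ord1.
Qed.

Lemma clifford_hadamard : clifford hadamard.
Proof.
have two_neq0 : 2 != 0 :> C by rewrite pnatr_eq0.
apply: cliffordP => [||a b].
- apply: operatorP => x y; rewrite entry_adj !entry_mx_of rmorphM /= sg_conj rsqrt2_conj.
  by rewrite [y 0 * _]mulrC.
- apply: operatorP => x y; rewrite entry_mulmx entry1 sum_bits1 !entry_mx_of !ffunE.
  rewrite mulrACA [X in _ + X]mulrACA -!sgD -mulrDr rsqrt2_sqr.
  have -> : x 0 * 0 + 0 * y 0 = 0 by ring.
  have -> : x 0 * 1 + 1 * y 0 = x 0 + y 0 by ring.
  rewrite sum_sg mulKf // bits1_eq addr_eq0 bit_opp //.
(* The Hadamard operator exchanges X and Z; the sign comes from reordering [X^b Z^a] as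
   [Z^a X^b]. *)
- exists (2 * ((a 0 * b 0)%R : nat))%N, b, a.
  rewrite -monoDl; apply: operatorP => x y.
  have E z : entry (hadamard *m pauli a b) x z =
      rsqrt2 * sg ((x 0 + b 0) * (z 0 + a 0)).
    rewrite entry_mulmx.
    have := sum_delta (fun w : bits 1 => rsqrt2 * sg ((x 0 + b 0) * w 0)) (z + a).
    rewrite [(z + a) 0]ffunE => <-; apply: eq_bigr => w _.
    rewrite entry_mx_of entry_mono dot1 mulrDl sgD !mulrA; congr (_ * (_ : bool)%:R).
    by apply/eqP/eqP => ->; rewrite bits_addK.
  rewrite entry_mulmx sum_bits1 entry_mono !E !entry_mx_of !ffunE dot1.
  rewrite mulrACA [X in _ + X]mulrACA -!sgD -mulrDr rsqrt2_sqr.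
  have -> : (x 0 + b 0) * (0 + a 0) + 0 * y 0 = (a 0 * b 0 + a 0 * x 0) + 0 by ring.
  have -> : (x 0 + b 0) * (1 + a 0) + 1 * y 0 =
    (a 0 * b 0 + a 0 * x 0) + (x 0 + b 0 + y 0) by ring.
  rewrite !(sgD (_ + _ * x 0)) -mulrDr sum_sg mulrCA mulKf // bits1_eq ffunE.
  by rewrite addr_eq0 bit_opp [_ == y 0]eq_sym.
Qed.

Lemma bool_mulr (a b : bool) : a%:R * b%:R = (a && b)%:R :> C.
Proof. by case: a; rewrite ?mul1r ?mul0r. Qed.

(** * Circuits *)

Lemma amp_act_on_mono n k (q : 'I_k -> 'I_n) pi p psi (x x' : bits n) :
  [ffun l => x' (q l)] = pi [ffun l => x (q l)] ->
  (forall j, j \notin codom q -> x' j = x j) ->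
  amp (act_on q (mono pi p) *m psi) x = sg (p [ffun l => x (q l)]) * amp psi x'.
Proof.
move=> x'q x'_off.
rewrite amp_mulmx -(sum_delta (fun z => sg (p [ffun l => x (q l)]) * amp psi z)).
apply: eq_bigr => z _; rewrite entry_mx_of entry_mono -!mulrA; congr (_ * _).
rewrite mulrA bool_mulr [RHS]mulrC; congr ((_ : bool)%:R * _).
apply/andP/eqP => [[/eqP on /forallP off]|->].
  apply/ffunP => j; have [/codomP[l ->]|jq] := boolP (j \in codom q).
    by move: x'q; rewrite -on => /ffunP/(_ l); rewrite !ffunE.
  by move: (off j); rewrite (negbTE jq) x'_off //= => /eqP.
rewrite x'q eqxx; split=> //; apply/forallP => j.
by have [//|jq] := boolP (j \in codom q); rewrite x'_off ?eqxx.
Qed.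

Definition phase_state n (f : bits n -> 'I_2) : state n :=
  state_of (fun x => rsqrt2 ^+ n * sg (f x)).

Lemma eq_phase_state n (f g : bits n -> 'I_2) :
  f =1 g -> phase_state f = phase_state g.
Proof. by move=> fg; apply: stateP => x; rewrite !amp_state_of fg. Qed.

Definition qubit_pair n (a b : 'I_n) (l : 'I_2) : 'I_n := if l == 0 then a else b.

Lemma qubit_pair_inj n (a b : 'I_n) : a != b -> injective (qubit_pair a b).
Proof.
rewrite /qubit_pair => ab l l'.
have [->|->] := bit_cases l; have [->|->] := bit_cases l' => //= e;
  by move: ab; rewrite e eqxx.
Qed.

Definition update n (x : bits n) (b : 'I_n) (e : 'I_2) : bits n :=
  [ffun j => if j == b then e else x j].

Lemma act_pair_gate n (a b : 'I_n) (c s t : 'I_2) f : a != b ->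
  act_on (qubit_pair a b) (pair_gate c s t) *m phase_state f =
  phase_state (fun x => t * x a * x b + s * x a * (x b + c * x a) +
                        f (update x b (x b + c * x a))).
Proof.
move=> ab; apply: stateP => x; rewrite pair_gateE.
rewrite (amp_act_on_mono _ _ (x' := update x b (x b + c * x a))).
- rewrite !amp_state_of [in RHS]sgD mulrCA; congr (_ * (sg _ * _)).
  by rewrite !ffunE.
- by apply: bits2P; rewrite !ffunE /qubit_pair /= ?eqxx ?(negbTE ab).
- move=> j jq; rewrite ffunE; case: eqP => // jb; case/negP: jq.
  by apply/codomP; exists 1; rewrite jb.
Qed.

Definition prepares n (S : state n -> Prop) m k (psi : state m) : Prop :=
  exists A : algorithm R n m, final_prob S A psi = 1 /\ cz_complexity A = k.

(* [phi] can be obtained from [psi] with [k] two-qubit gates. *)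
Definition leads n k (psi phi : state n) : Prop :=
  forall n' (S : state n' -> Prop) k', prepares S k' phi -> prepares S (k' + k) psi.

Lemma leads_refl n (psi : state n) : leads 0 psi psi.
Proof. by move=> n' S k'; rewrite addn0. Qed.

Lemma leads_trans n k1 k2 (psi phi chi : state n) :
  leads k1 psi phi -> leads k2 phi chi -> leads (k1 + k2) psi chi.
Proof. by move=> H1 H2 n' S k' /H2/H1; rewrite -addnA [(k2 + _)%N]addnC. Qed.

Lemma leads_gate1 n v (U : operator 1) (psi : state n) : clifford U ->
  leads 0 psi (act_on (fun=> v) U *m psi).
Proof.
move=> UC n' S k' [A [A1 A2]]; exists (Gate1 v UC A).
by split; [exact: A1|rewrite /= A2 addn0].
Qed.

Lemma leads_gate2 n (q : 'I_2 -> 'I_n) (U : operator 2) (psi : state n) :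
  injective q -> clifford U -> leads 1 psi (act_on q U *m psi).
Proof.
move=> qI UC n' S k' [A [A1 A2]]; exists (Gate2 qI UC A).
by split; [exact: A1|rewrite /= A2 addn1].
Qed.

Definition plus_on n (s : seq 'I_n) : state n :=
  state_of (fun x => rsqrt2 ^+ size s * [forall j, (j \in s) || (x j == 0)]%:R).

(** Qubit [v] is still in the zero state, so only the string [update x v 0] contributes to the
    amplitude at [x], with coefficient [rsqrt2] for either value of [x v]. *)
Lemma act_hadamard n (v : 'I_n) s : v \notin s ->
  act_on (fun=> v) hadamard *m plus_on s = plus_on (v :: s).
Proof.
move=> vs; apply: stateP => x; rewrite amp_mulmx amp_state_of.
pose K : C := rsqrt2 ^+ (size s).+1 * [forall j, (j \in v :: s) || (x j == 0)]%:R.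
rewrite -[RHS]/K -(sum_delta (fun=> K) (update x v 0)); apply: eq_bigr => y _.
rewrite !entry_mx_of !ffunE amp_state_of.
case: (eqVneq y (update x v 0)) => [->|neq].
  rewrite !ffunE eqxx mulr0 sg0 !mulr1 /K exprS.
  have -> : [forall j, (j \in codom (fun _ : 'I_1 => v)) || (x j == update x v 0 j)].
    apply/forallP => j; rewrite ffunE; case: (eqVneq j v) => [->|_]; last by rewrite eqxx orbT.
    by rewrite (_ : v \in _) //; apply/codomP; exists 0.
  rewrite mulr1 -!mulrA; congr (_ * (_ * (_ : bool)%:R)); apply: eq_forallb => j.
  by rewrite ffunE inE; case: (eqVneq j v) => [->|_]; rewrite ?eqxx ?orbT.
rewrite mulr0; case: forallP => [agree|_]; last by rewrite mulr0 mul0r.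
case: forallP => [zero|_]; last by rewrite !mulr0.
case/eqP: neq; apply/ffunP => j; rewrite ffunE; case: (eqVneq j v) => [->|jv].
  by apply/eqP; move: (zero v); rewrite (negbTE vs).
apply/eqP; move: (agree j); rewrite eq_sym; case: codomP => // -[_ jv'].
by rewrite jv' eqxx in jv.
Qed.

Lemma leads_plus n : leads 0 (zero_state R n) (phase_state (fun _ : bits n => 0)).
Proof.
have -> : zero_state R n = plus_on [::].
  by apply: stateP => x; rewrite !amp_state_of mul1r.
have -> : phase_state (fun _ : bits n => 0) = plus_on (enum 'I_n).
  apply: stateP => x; rewrite !amp_state_of size_enum_ord.
  by have -> : [forall j, (j \in enum 'I_n) || (x j == 0)]
    by apply/forallP => j; rewrite mem_enum.
elim: (enum 'I_n) (enum_uniq 'I_n) => [_|v s IH] /=; first exact: leads_refl.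
move=> /andP[vs us]; apply: (leads_trans (IH us)); rewrite -act_hadamard //.
by apply: leads_gate1; apply: clifford_hadamard.
Qed.

(** * Quadratic phases and graph states *)

Definition quadratic n (r : 'I_n) (E : 'I_n -> 'I_n -> bool) (L : 'I_n -> bool)
    (x : bits n) : 'I_2 :=
  \sum_u \sum_w (E u w)%:R * x u * x w + x r * \sum_w (L w)%:R * x w.

Lemma natr_addb (a b : bool) : (a (+) b)%:R = a%:R + b%:R :> 'I_2.
Proof. by case: a; case: b => //=; apply: val_inj. Qed.

Lemma natr_andb (a b : bool) : (a && b)%:R = a%:R * b%:R :> 'I_2.
Proof. by case: a; rewrite ?mul1r ?mul0r. Qed.

Lemma sum_pick n (b : 'I_n) (g : 'I_n -> bool) (x : bits n) :
  \sum_w ((w == b) && g w)%:R * x w = (g b)%:R * x b.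
Proof.
rewrite (bigD1 b) //= eqxx big1 ?addr0 // => w /negbTE ->.
by rewrite mul0r.
Qed.

Lemma sum_row n (v : 'I_n) (g : 'I_n -> bool) (x : bits n) :
  \sum_u \sum_w ((u == v) && g w)%:R * x u * x w = x v * \sum_w (g w)%:R * x w.
Proof.
rewrite (bigD1 v) //= eqxx [X in _ + X]big1 => [|u /negbTE ->].
  by rewrite addr0 mulr_sumr; apply: eq_bigr => w _; rewrite mulrAC mulrC.
by rewrite big1 // => w _; rewrite !mul0r.
Qed.

Lemma quadratic_addE n r E E' L (x : bits n) :
  quadratic r (fun u w => E u w (+) E' u w) L x =
  quadratic r E L x + \sum_u \sum_w (E' u w)%:R * x u * x w.
Proof.
rewrite /quadratic addrAC; congr (_ + _).
rewrite -big_split; apply: eq_bigr => u _; rewrite -big_split; apply: eq_bigr => w _.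
by rewrite natr_addb !mulrDl.
Qed.

Lemma quadratic_update n (r : 'I_n) E L (x : bits n) e :
  (forall u, E u r = false /\ E r u = false) -> L r = false ->
  quadratic r E L (update x r e) =
  \sum_u \sum_w (E u w)%:R * x u * x w + e * \sum_w (L w)%:R * x w.
Proof.
move=> Er Lr; rewrite /quadratic; congr (_ + _ * _).
- apply: eq_bigr => u _; apply: eq_bigr => w _; rewrite !ffunE.
  case: (eqVneq u r) => [->|_]; first by rewrite (Er w).2 !mul0r.
  by case: (eqVneq w r) => [->|_] //; rewrite (Er u).1 !mul0r.
- by rewrite ffunE eqxx.
- by apply: eq_bigr => w _; rewrite ffunE; case: eqP => // ->; rewrite Lr !mul0r.
Qed.

(** Induction on [reach]. A symmetric matrix with zero diagonal would give the zero form modulo 2,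
    so [E] is directed: [uw] is an edge when exactly one of [E u w] and [E w u] holds. *)
Lemma realize n (r : 'I_n) k S L : reach r k S L ->
  exists E : 'I_n -> 'I_n -> bool,
    [/\ forall u, [/\ E u u = false, E u r = false & E r u = false],
        forall u w, E u w (+) E w u = S u w, L r = false &
        leads k (zero_state R n) (phase_state (quadratic r E L))].
Proof.
elim=> {k S L}.
- exists (fun _ _ => false); split => //.
  rewrite (eq_phase_state (g := fun=> 0)); first exact: leads_plus.
  move=> x; rewrite /quadratic !big1 ?mulr0 ?addr0 // => u _; rewrite ?mul0r //.
  by rewrite big1 // => w _; rewrite !mul0r.
- move=> k S L a b ab ar br _ [E [E0 ES Lr H]].
  exists (fun u w => E u w (+) (u == a) && (w == b)); split => //.
  + move=> u; have [-> -> ->] := E0 u; rewrite ![r == _]eq_sym (negbTE ar) (negbTE br).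
    by rewrite andbF; split => //; case: eqP => // ->; rewrite (negbTE ab).
  + move=> u w; rewrite -ES.
    have : ~~ ((u == a) && (u == b)) by case: (eqVneq u a) => [->|].
    rewrite [(w == a) && _]andbC; move: (E u w) (E w u).
    by case: (u == a); case: (u == b); case: (w == a); case: (w == b) => // [] [] [].
  rewrite -addn1; apply: leads_trans H _.
  (* With parameters 0, 0, 1 the pair gate is a plain CZ. *)
  have := @leads_gate2 _ _ _ (phase_state (quadratic r E L)) (qubit_pair_inj ab)
    (clifford_pair_gate 0 0 1).
  rewrite act_pair_gate //; congr leads; apply: eq_phase_state => x.
  rewrite quadratic_addE sum_row.
  under eq_bigr do rewrite -[_ == b]andbT.
  rewrite sum_pick mul0r addr0 !mul0r addr0 [LHS]addrC; congr (_ + _); last by rewrite !mul1r.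
  by congr quadratic; apply/ffunP => j; rewrite ffunE; case: eqP => // ->.
- move=> k S L v t c vr _ [E [E0 ES Lr H]].
  exists (fun u w => E u w (+) (u == v) && [&& c, w != v & L w]); split.
  + move=> u; have [-> -> ->] := E0 u; rewrite [r == _]eq_sym (negbTE vr) Lr !andbF.
    by split => //; case: eqP => //= _; rewrite andbF.
  + move=> u w; rewrite -ES.
    case: (eqVneq u v) => [->|uv]; case: (eqVneq w v) => [->|wv];
      rewrite ?eqxx ?[v == _]eq_sym ?uv ?wv /= ?andbF ?addbF //.
      by move: (E _ _) (E _ _) (L _) (c) => [] [] [] [].
    by move: (E _ _) (E _ _) (L _) (c) => [] [] [] [].
  + by rewrite eq_sym (negbTE vr).
  rewrite -addn1; apply: leads_trans H _.
  have := @leads_gate2 _ _ _ (phase_state (quadratic r E L)) (qubit_pair_inj vr)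
    (clifford_pair_gate c%:R (L v)%:R t%:R).
  rewrite act_pair_gate //; congr leads; apply: eq_phase_state => x.
  rewrite quadratic_addE sum_row quadratic_update //; last by move=> u; have [] := E0 u.
  rewrite /quadratic.
  pose B := \sum_w ((w != v) && L w)%:R * x w.
  have -> : \sum_w (L w)%:R * x w = (L v)%:R * x v + B.
    rewrite -sum_pick -big_split; apply: eq_bigr => w _ /=.
    by rewrite -mulrDl -natr_addb; case: (w == v); case: (L w).
  have -> : \sum_w (if w == v then t else L w)%:R * x w = t%:R * x v + B.
    rewrite -(sum_pick v (fun=> t)) -big_split; apply: eq_bigr => w _ /=.
    by rewrite -mulrDl -natr_addb; case: (w == v); case: (L w); case: (t).
  have -> : \sum_w [&& c, w != v & L w]%:R * x w = c%:R * B.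
    by rewrite mulr_sumr; apply: eq_bigr => w _; rewrite natr_andb mulrA.
  (* These terms occur twice on the left: removing [v] from the register cancels its old
     membership. *)
  rewrite -[RHS]addr0 -[X in _ = _ + X](bit_addxx
    ((L v)%:R * x v * x r + (L v)%:R * c%:R * x v * x v)).
  ring.
Qed.

Lemma sum_flip n (v : 'I_n) (g : 'I_n -> 'I_2) :
  \sum_u g u * (u == v)%:R = g v.
Proof.
rewrite (bigD1 v) //= eqxx mulr1 big1 ?addr0 // => u /negbTE ->.
by rewrite mulr0.
Qed.

(** The linear term is the polarization of the quadratic form, evaluated at the unit vector of
    [v]. *)
Lemma quadratic_flip n (F : 'I_n -> 'I_n -> 'I_2) (v : 'I_n) (x : bits n) :
  \sum_u \sum_w F u w * (x u + (u == v)%:R) * (x w + (w == v)%:R) =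
  \sum_u \sum_w F u w * x u * x w + \sum_w (F v w + F w v) * x w + F v v.
Proof.
transitivity (\sum_u \sum_w (F u w * x u * x w + (F u w * x u) * (w == v)%:R +
   (F u w * x w) * (u == v)%:R + F u w * (u == v)%:R * (w == v)%:R)).
  by apply: eq_bigr => u _; apply: eq_bigr => w _; ring.
under eq_bigr do rewrite !big_split /= !sum_flip -mulr_suml.
rewrite !big_split /= !sum_flip -!addrA; congr (_ + _); rewrite !addrA.
by congr (_ + _); rewrite addrC -big_split; apply: eq_bigr => w _ /=; rewrite mulrDl.
Qed.

(** The stabilizer at [v] flips [x v] and multiplies by the sign of the sum of [x w] over the
    neighbours [w]. Flipping [x v] changes the quadratic form by the same sum, so the two signs
    cancel. *)
Lemma phase_graph_state n (G : sgraph n) (r : 'I_n) E L :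
  (forall u, E u u = false) -> L r = false ->
  (forall u w, G u w = E u w (+) E w u (+) ((u == r) && L w (+) (w == r) && L u)) ->
  is_graph_state G (phase_state (quadratic r E L)).
Proof.
move=> E0 Lr GE.
pose F u w : 'I_2 := (E u w (+) (u == r) && L w)%:R.
have quadE x : quadratic r E L x = \sum_u \sum_w F u w * x u * x w.
  rewrite /quadratic -sum_row -big_split; apply: eq_bigr => u _.
  rewrite -big_split; apply: eq_bigr => w _ /=.
  by rewrite /F natr_addb !mulrDl.
split.
  apply/negP => /eqP/(congr1 (fun psi => amp psi 0)).
  rewrite amp_state_of /amp mxE => /eqP; rewrite mulf_eq0 expf_eq0 invr_eq0 sqrtC_eq0.
  by rewrite pnatr_eq0 /sg expf_eq0 oppr_eq0 oner_eq0 !andbF.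
move=> v; apply: stateP => x.
pose a : bits n := [ffun w => (w == v)%:R]; pose b : bits n := [ffun w => (G v w)%:R].
(* No phase arises: X sits only on [v] and Z only on its neighbours, so there is no Y factor. *)
have -> : graph_stabilizer R G v = pauli a b.
  rewrite -tensor_pauli1 big1 => [|j _]; last first.
    rewrite !ffunE; case: eqP => [->|//]; by rewrite edge_irr muln0.
  rewrite scale1r; congr tensor; apply/funext => w; rewrite !ffunE /pauli1.
  by case: (eqVneq w v) => [->|_]; rewrite ?edge_irr //; case: (G v w).
rewrite amp_mono !amp_state_of mulrCA -sgD; congr (_ * sg _).
rewrite !quadE.
have -> : \sum_u \sum_w F u w * (x + a) u * (x + a) w =
   \sum_u \sum_w F u w * (x u + (u == v)%:R) * (x w + (w == v)%:R).
  by apply: eq_bigr => u _; apply: eq_bigr => w _; rewrite !ffunE.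
rewrite quadratic_flip.
have -> : F v v = 0 by rewrite /F E0; case: eqP => // ->; rewrite Lr.
have -> : \sum_w (F v w + F w v) * x w = dot b x.
  apply: eq_bigr => w _; rewrite ffunE GE /F -natr_addb; congr (_%:R * _).
  by case: (E v w); case: (E w v); case: (_ && _); case: (_ && _).
by rewrite addr0 addrCA bit_addxx addr0.
Qed.

Lemma sqnorm_phase n (f : bits n -> 'I_2) : sqnorm (phase_state f) = 1.
Proof.
rewrite /sqnorm (eq_bigr (fun=> 2^-1 ^+ n)) => [|x _].
  rewrite sumr_const card_ffun !card_ord -[LHS]mulr_natr natrX -exprMn mulVf ?expr1n //.
rewrite amp_state_of normCK rmorphM rmorphXn /= rsqrt2_conj sg_conj.
by rewrite mulrACA sg_mulxx mulr1 -exprMn rsqrt2_sqr.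
Qed.

Lemma Gamma_CZ_le n (G : sgraph n) (r : 'I_n) k S L :
  reach r k S L ->
  (forall u w, G u w = S u w (+) ((u == r) && L w (+) (w == r) && L u)) ->
  (Gamma_CZ R G <= (k%:R)%:E)%E.
Proof.
move=> /realize[E [E0 ES Lr H]] GS.
have Gst : is_graph_state G (phase_state (quadratic r E L)).
  apply: phase_graph_state => // [u|u w]; first by have [] := E0 u.
  by rewrite GS ES.
have : prepares (is_graph_state G) (0 + k) (zero_state R n).
  apply: H; exists (Stop R n); split => //=.
  by rewrite asboolT // sqnorm_phase.
rewrite add0n => prep.
apply: ereal_inf_lbound; exists k => //; exists 0%N.
rewrite /generates addn0; exact: prep.
Qed.

End Operators.

(* 2/5 is slightly more than 1/2.524, where 2.524 = 2 * 1.262. *)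
Lemma le_log2 (R : realType) N t : (4 ^ t.+2 <= (N + 2) ^ 5)%N ->
  2 / 5 * t.+2%:R <= log2 (N%:R + 2 : R).
Proof.
move=> le_t; have ln2 : 0 < ln (2 : R) by rewrite ln_gt0 // ltr1n.
rewrite /log2 ler_pdivlMr //.
have N2 : 0 < N%:R + 2 :> R by rewrite ltr_wpDl.
have : 2 ^+ (2 * t.+2) <= (N%:R + 2) ^+ 5 :> R.
  by move: le_t; rewrite -(ler_nat R) !natrX natrD exprM -(natrX _ 2 2).
rewrite -ler_ln ?posrE ?exprn_gt0 // !lnXn //.
rewrite -(mulr_natl (ln 2)) -(mulr_natl (ln (_ + _))) natrM.
lra.
Qed.

Theorem theorem9 (R : realType) (n : nat) (hn : (1 <= n)%N) (G : sgraph n) :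
  (interval_graph G -> (Gamma_CZ R G <= (2 * n%:R - 2)%:E)%E) /\
  (circle_graph G ->
     (Gamma_CZ R G <=
        (1262 / 1000 * (n%:R - 1) * log2 (n%:R + 1))%:E)%E).
Proof.
pose v0 := Ordinal hn.
have n_pred : n%:R - 1 = n.-1%:R :> R.
  by rewrite -[in LHS](prednK hn) -natr1 addrK.
split=> [[m hm Gm]|[m hm Gm]].
- pose r := [arg max_(v > v0) index v m].
  have r_max v : (index v m <= index r m)%N.
    by rewrite /r; case: arg_maxnP => // i _ /(_ v isT).
  have [k le_k reach_k] := reach_interval hm r_max.
  apply: le_trans (Gamma_CZ_le R reach_k _) _ => [u w|].
    rewrite Gm; case: (eqVneq u r) => [->|ur]; case: (eqVneq w r) => [->|wr];
      rewrite /= ?addbF ?andbF ?[r == _]eq_sym ?ur ?wr ?eqxx //=.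
    by rewrite nestedC interlacedC.
  rewrite lee_fin (_ : 2 * n%:R - 2 = (2 * n.-1)%N%:R) ?ler_nat //.
  rewrite natrM -n_pred; ring.
- have bound t : (n.-1 <= capacity t)%N ->
      (Gamma_CZ R G <= (t.+2%:R / 2 * n.-1%:R)%:E)%E.
    move=> le_n; have [k le_k reach_k] := reach_circle hm v0 le_n.
    apply: le_trans (Gamma_CZ_le R reach_k _) _ => [u w|].
      rewrite Gm; case: (eqVneq u v0) => [->|uv]; case: (eqVneq w v0) => [->|wv];
        rewrite /= ?addbF ?andbF ?[v0 == _]eq_sym ?uv ?wv ?eqxx //=.
      by rewrite interlacedC.
    move: le_k; rewrite lee_fin -(ler_nat R) !natrM; lra.
  (* With a single vertex the bound is 0; otherwise [capacity_choose] applies to the [n.-1] vertices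
     besides the register. *)
  rewrite n_pred; have [n0|n0] := posnP n.-1.
    by have := bound 0%N; rewrite n0 !mulr0 mul0r; apply.
  have [t le_n le_t] := capacity_choose n0.
  apply: le_trans (bound t le_n) _; rewrite lee_fin.
  have := le_log2 R le_t.
  rewrite (_ : n.-1%:R + 2 = n%:R + 1); last by rewrite -n_pred; ring.
  (* The choice of [t] gives [t.+2 / 2 <= 5/4 * l], where [l] is the logarithm, and [5/4 < 1.262];
     that [l] is non-negative follows from the same bound. *)
  have : 0 <= n.-1%:R :> R by [].
  have : 0 <= t.+2%:R :> R by [].
  move: (log2 _) (n.-1%:R) (t.+2%:R) => l y z z0 y0 le_l.
  rewrite [leRHS]mulrAC; apply: ler_wpM2r => //; lra.
Qed.
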